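(* For $c\in[1,\infty)$ and $\delta\ge0$, let $\gamma^{\delta,c}(k,r)=(k-\delta,cr+\delta)$. For any $c\in[1,3)$: (i) there exist non-empty finite subsets $X$ and $Y$ of a good metric space and $\delta>d_{Pr}(\nu_X,\nu_Y)$ such that the normalized degree-Čech bifiltrations $\mathcal{D\check C}(X)$ and $\mathcal{D\check C}(Y)$ are not $\gamma^{\delta,c}$-homotopy interleaved; (ii) there exist non-empty finite metric spaces $X$ and $Y$ and $\delta>d_{GPr}(\mu_X,\mu_Y)$ such that the normalized degree-Rips bifiltrations $\mathcal{DR}(X)$ and $\mathcal{DR}(Y)$ are not $\gamma^{\delta,c}$-homotopy interleaved.
   Context: **Good metric spaces.** A metric space is good if the intersection of any finite collection of open balls is either empty or contractible. $B(x,r)$ denotes the open ball of radius $r$ centered at $x$. **Measures.** For $X$ a non-empty finite metric space, $\mu_X$ is the uniform probability measure, $\mu_X(A)=|A|/|X|$. If $X\subset Z$ for a metric space $Z$, $\nu_X$ is the Borel measure on $Z$ given by $\nu_X(A)=|A\cap X|/|X|$. The Prohorov distance between Borel measures $\mu,\eta$ on a metric space $Z$ is \[ d_{Pr}(\mu,\eta)=\sup_A\inf\{\delta\ge 0 \mid \mu(A)\le\eta(A^\delta)+\delta \text{ and } \eta(A)\le\mu(A^\delta)+\delta\}, \] where $A\subset Z$ ranges over closed sets and $A^\delta$ is the set of points of $Z$ at distance $<\delta$ from some $a\in A$. The Gromov–Prohorov distance between metric measure spaces $\mathcal X,\mathcal Y$ with measures $\eta_{\mathcal X},\eta_{\mathcal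 Y}$ is $d_{GPr}(\mathcal X,\mathcal Y)=\inf_{\varphi,\psi}d_{Pr}(\varphi_*\eta_{\mathcal X},\psi_*\eta_{\mathcal Y})$, where $\varphi:\mathcal X\to W$, $\psi:\mathcal Y\to W$ range over isometric embeddings into a common metric space $W$; a metric measure space is denoted by its measure. **Bifiltrations.** $J=(0,\infty)^{\mathrm{op}}\times(0,\infty)$, so $(k,r)\le(k',r')$ iff $k\ge k'$ and $r\le r'$. All bifiltrations below are functors from $J$ to topological spaces with internal maps inclusions; simplicial complexes are regarded as spaces via geometric realization. - For $X\subset Z$, the Čech complex $\check{\mathcal C}(X)_r$ is the nerve of the balls $B(x,r)\subset Z$, $x\in X$: its vertex set is $X$ (balls are indexed by their centers), and its simplices are the non-empty finite $\sigma\subset X$ with $\bigcap_{x\in\sigma}B(x,r)\ne\emptyset$. - For a metric space $(X,\partial_X)$, the Rips complex $\mathcal R(X)_r$ is the clique complex of the graph with vertex set $X$ and edges $[x,y]$, $x\neq y$, $\partial_X(x,y)<2r$. - For a simplicial complex $T$ and $k>0$, $\mathcal D(T)_k$ is the maximum subcomplex of $T$ all of whose vertices have degree at least $k-1$ in the 1-skeleton of $T$. - For $X$ non-empty finite, $\mathcal{D\check C}(X)_{(k,r)}=\mathcal D(\check{\mathcal C}(X)_r)_{k|X|}$ and $\mathcal{DR}(X)_{(k,r)}=\mathcal D(\mathcal R(X)_r)_{k|X|}$. **Interleavings.** A forward shift is a poset automorphism $\gamma$ of $\mathbb R^{\mathrm{op}}\times\mathbb R$ (ordered by $(a,b)\le(c,d)$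 iff $a\ge c$ and $b\le d$) with $x\le\gamma(x)$ for all $x\in J$. For forward shifts $\gamma,\kappa$, the thin category $\mathbf I^{\gamma,\kappa}$ has objects $J\times\{0,1\}$ and a morphism $(r,i)\to(s,j)$ iff: $i=j$ and $r\le s$; or $i=0,j=1$ and $\gamma(r)\le s$; or $i=1,j=0$ and $\kappa(r)\le s$. Functors $F,G:J\to\mathbf{Top}$ are $(\gamma,\kappa)$-interleaved if there is a functor $\mathbf I^{\gamma,\kappa}\to\mathbf{Top}$ restricting to $F$ on $J\times\{0\}$ and to $G$ on $J\times\{1\}$. Functors $F,G:J\to\mathbf{Top}$ are weakly equivalent if they are connected by a finite zigzag of natural transformations each of which is objectwise a weak homotopy equivalence. $F,G$ are $(\gamma,\kappa)$-homotopy interleaved if there are $F'$ weakly equivalent to $F$ and $G'$ weakly equivalent to $G$ with $F',G'$ $(\gamma,\kappa)$-interleaved; $\gamma$-homotopy interleaved means $(\gamma,\gamma)$-homotopy interleaved. *)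

(* Defs.v *)
From HB Require Import structures.
From Stdlib Require Import Relations.
From mathcomp Require Import all_boot all_order all_algebra finmap.
From mathcomp Require Import all_classical all_reals all_analysis.

Set Implicit Arguments.
Unset Strict Implicit.
Unset Printing Implicit Defensive.
Import Order.TTheory GRing.Theory Num.Theory.
Import numFieldNormedType.Exports.

Local Open Scope classical_set_scope.
Local Open Scope ring_scope.

(* Measures require pointed carriers, so a non-empty metric space comes with an
   (otherwise unused) base point. *)
#[short(type="pmetricType")]
HB.structure Definition PMetric (K : numDomainType) :=
  {M of Metric K M & Pointed M}.

Section Homotopy.
Variable R : realType.

Definition unitI : topologicalType := set_type (`[0, 1]%classic : set R).

Definition homotopic_rel (S T : topologicalType) (A : set S) (f g : S -> T) :=
  exists H : S * unitI -> T,
    [/\ continuous H,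
        forall s t, set_val t = 0 -> H (s, t) = f s,
        forall s t, set_val t = 1 -> H (s, t) = g s &
        forall s t, A s -> H (s, t) = f s].

Definition contractible (T : topologicalType) :=
  exists x0 : T, homotopic_rel set0 idfun (fun _ : T => x0).

Definition joined (T : topologicalType) (x y : T) :=
  exists p : unitI -> T,
    [/\ continuous p,
        forall t, set_val t = 0 -> p t = x &
        forall t, set_val t = 1 -> p t = y].

Definition cube (n : nat) : topologicalType :=
  set_type [set p : {ptws 'I_n -> R} | forall i, 0 <= p i <= 1].

Definition cube_boundary (n : nat) : set (cube n) :=
  [set p | exists i, set_val p i = 0 \/ set_val p i = 1].
Arguments cube_boundary n : clear implicits.

(* The elements of pi_n(T, x) are the classes of [sphere_at n x] modulo
   [homotopic_rel (cube_boundary n)]. *)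
Definition sphere_at (n : nat) (T : topologicalType) (x : T) :
    set (cube n -> T) :=
  [set a | continuous a /\ forall p, cube_boundary n p -> a p = x].
Arguments sphere_at n {T} x.

(* f is bijective on pi_0 and on every pi_n(S, x), n >= 1; the latter maps are
   group homomorphisms, hence isomorphisms. The condition on pi_0 is separate
   because S or T may be empty. *)
Definition weak_homotopy_equivalence (S T : topologicalType) (f : S -> T) :=
  [/\ continuous f,
      forall x y, joined (f x) (f y) -> joined x y,
      forall z, exists x, joined (f x) z,
      forall n x a b, (0 < n)%N -> sphere_at n x a -> sphere_at n x b ->
        homotopic_rel (cube_boundary n) (f \o a) (f \o b) ->
        homotopic_rel (cube_boundary n) a b &
      forall n x b, (0 < n)%N -> sphere_at n (f x) b ->
        exists2 a, sphere_at n x a &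
          homotopic_rel (cube_boundary n) (f \o a) b].

End Homotopy.
Arguments sphere_at {R} n {T} x.
Arguments cube_boundary {R} n.

Record thin_category := ThinCategory {
  obj :> Type;
  hom : obj -> obj -> Prop;
  hom_refl : forall x, hom x x;
  hom_trans : forall x y z, hom x y -> hom y z -> hom x z }.

Record diagram (C : thin_category) := Diagram {
  space_at :> C -> topologicalType;
  map_of : forall x y, hom x y -> space_at x -> space_at y;
  map_of_continuous : forall x y (h : hom x y), continuous (map_of h);
  map_of_id : forall x (h : hom x x), map_of h =1 idfun;
  map_of_comp : forall x y z (h : hom x y) (k : hom y z) (l : hom x z),
    map_of l =1 map_of k \o map_of h }.

Arguments map_of {C} d {x y} h.
Arguments map_of_continuous {C} d {x y} h.
Arguments map_of_id {C} d {x} h.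
Arguments map_of_comp {C} d {x y z} h k l.

Section Restriction.
Variables (C D : thin_category) (u : C -> D).
Hypothesis hu : forall x y, hom x y -> hom (u x) (u y).
Variable F : diagram D.

Definition restriction : diagram C :=
  @Diagram C (fun x => F (u x)) (fun x y h => map_of F (hu h))
    (fun x y h => map_of_continuous F (hu h))
    (fun x h => map_of_id F (hu h))
    (fun x y z h k l => map_of_comp F (hu h) (hu k) (hu l)).

End Restriction.

Record transformation (C : thin_category) (F G : diagram C) := Transformation {
  component :> forall x, F x -> G x;
  component_continuous : forall x, continuous (@component x);
  naturality : forall x y (h : hom x y),
    @component y \o map_of F h =1 map_of G h \o @component x }.

Section Interleavings.
Variable R : realType.

Definition objectwise_weak_equivalence (C : thin_category) (F G : diagram C) :=
  exists eta : transformation F G,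
    forall x, weak_homotopy_equivalence R (eta x).

Definition weakly_equivalent (C : thin_category) : relation (diagram C) :=
  clos_refl_sym_trans _ (@objectwise_weak_equivalence C).

(* The order of R^op x R. *)
Definition le2 (p q : R * R) : bool := (q.1 <= p.1) && (p.2 <= q.2).

Lemma le2_refl p : le2 p p.
Proof. by rewrite /le2 !lexx. Qed.

Lemma le2_trans p q s : le2 p q -> le2 q s -> le2 p s.
Proof.
rewrite /le2 => /andP[a b] /andP[c d]; apply/andP; split.
  exact: le_trans c a.
exact: le_trans b d.
Qed.

Definition Jobj := {p : R * R | (0 < p.1) && (0 < p.2)}.

Definition J : thin_category :=
  @ThinCategory Jobj (fun x y => le2 (sval x) (sval y))
    (fun x => le2_refl (sval x))
    (fun x y z => @le2_trans (sval x) (sval y) (sval z)).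

Record forward_shift := ForwardShift {
  shift :> R * R -> R * R;
  shift_bij : bijective shift;
  shift_mono : {mono shift : p q / le2 p q};
  shift_ge : forall x : Jobj, le2 (sval x) (shift (sval x)) }.

Section Category.
Variables gamma kappa : forward_shift.

Definition interleaving_hom (x y : Jobj * bool) : Prop :=
  match x.2, y.2 with
  | false, true => le2 (gamma (sval x.1)) (sval y.1)
  | true, false => le2 (kappa (sval x.1)) (sval y.1)
  | _, _ => le2 (sval x.1) (sval y.1)
  end.

Lemma interleaving_hom_refl x : interleaving_hom x x.
Proof. by case: x => x [] /=; exact: le2_refl. Qed.

Lemma interleaving_hom_trans x y z :
  interleaving_hom x y -> interleaving_hom y z -> interleaving_hom x z.
Proof.
case: x y z => [x i] [y j] [z k].
have up (s : forward_shift) : le2 (s (sval x)) (sval y) ->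
    le2 (sval x) (sval y).
  exact: (le2_trans (shift_ge s x)).
have up' (s : forward_shift) : le2 (s (sval y)) (sval z) ->
    le2 (sval y) (sval z).
  exact: (le2_trans (shift_ge s y)).
have sh (s : forward_shift) : le2 (sval x) (sval y) ->
    le2 (s (sval x)) (s (sval y)) by rewrite shift_mono.
case: i j k => [] [] [] /=; rewrite /interleaving_hom /= => xy yz.
- exact: le2_trans xy yz.
- exact: le2_trans (sh kappa xy) yz.
- exact: le2_trans (up _ xy) (up' _ yz).
- exact: le2_trans xy yz.
- exact: le2_trans xy yz.
- exact: le2_trans (up _ xy) (up' _ yz).
- exact: le2_trans (sh gamma xy) yz.
- exact: le2_trans xy yz.
Qed.

(* J x {0, 1}, with 0 encoded as false and 1 as true. *)
Definition interleaving_category : thin_category :=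
  @ThinCategory (Jobj * bool)%type interleaving_hom
    interleaving_hom_refl interleaving_hom_trans.

Definition copy (b : bool) (x : J) : interleaving_category := (x, b).

Lemma copy_hom b x y : hom x y -> hom (copy b x) (copy b y).
Proof. by case: b. Qed.

Definition interleaved (F G : diagram J) :=
  exists H : diagram interleaving_category,
    restriction (copy_hom false) H = F /\ restriction (copy_hom true) H = G.

Definition homotopy_interleaved2 (F G : diagram J) :=
  exists F' G' : diagram J,
    [/\ weakly_equivalent F' F, weakly_equivalent G' G & interleaved F' G'].

End Category.

Definition homotopy_interleaved (gamma : forward_shift) :=
  homotopy_interleaved2 gamma gamma.

Section LinearShift.
Variables delta c : R.
Hypotheses (hdelta : 0 <= delta) (hc : 1 <= c).

Definition linear_shift_fun (p : R * R) : R * R :=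
  (p.1 - delta, c * p.2 + delta).

Lemma linear_shift_bij : bijective linear_shift_fun.
Proof.
have c0 : c != 0 by rewrite gt_eqF// (lt_le_trans ltr01).
exists (fun p => (p.1 + delta, (p.2 - delta) / c)) => -[a b];
  rewrite /linear_shift_fun /=.
  by rewrite subrK addrK [c * b]mulrC mulfK.
by rewrite addrK [c * _]mulrC divfK// subrK.
Qed.

Lemma linear_shift_mono : {mono linear_shift_fun : p q / le2 p q}.
Proof.
move=> p q; rewrite /le2 /= lerD2r lerD2r ler_pM2l//.
exact: lt_le_trans ltr01 hc.
Qed.

Lemma linear_shift_ge (x : Jobj) :
  le2 (sval x) (linear_shift_fun (sval x)).
Proof.
case: x => -[a b] /= /andP[_ b0]; rewrite /le2 /= in b0 *.
rewrite gerBl hdelta /= -[leLHS]addr0 lerD// ler_peMl//; exact: ltW.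
Qed.

Definition linear_shift : forward_shift :=
  ForwardShift linear_shift_bij linear_shift_mono linear_shift_ge.

End LinearShift.

End Interleavings.

(* Only finite complexes are needed; x is a vertex of T iff [fset x] \in T. *)
Record complex (V : choiceType) := Complex {
  simplices :> {fset {fset V}};
  simplex_neq0 : fset0 \notin simplices;
  simplex_closed : forall s t : {fset V},
    s \in simplices -> (t `<=` s)%fset -> t != fset0 -> t \in simplices }.

Section Realization.
Variables (R : realType) (V : choiceType).

(* T is finite, so its realization carries the Euclidean topology, which is
   that of pointwise convergence of the barycentric coordinates. *)
Definition realization_set (T : complex V) : set {ptws V -> R} :=
  [set p | exists2 s : {fset V}, s \in simplices T &
    [/\ forall x, 0 <= p x, forall x, (p x != 0) = (x \in s) &
        \sum_(x <- s) p x = 1]].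

Definition realization (T : complex V) : topologicalType :=
  set_type (realization_set T).

Lemma realization_subset (T T' : complex V) :
  (simplices T `<=` simplices T')%fset ->
  realization_set T `<=` realization_set T'.
Proof. by move=> /fsubsetP TT' p [s sT ps]; exists s => //; exact: TT'. Qed.

Definition realization_inclusion (T T' : complex V)
    (h : (simplices T `<=` simplices T')%fset) :
    realization T -> realization T' :=
  fun p => SigSub (mem_set (realization_subset h (set_valP p))).

Lemma realization_inclusion_continuous T T' h :
  continuous (@realization_inclusion T T' h).
Proof.
apply: continuous_comp_initial => p.
exact: (@initial_continuous _ _ set_val).
Qed.

Variable T : J R -> complex V.
Hypothesis hT : forall x y,
  hom x y -> (simplices (T x) `<=` simplices (T y))%fset.

Definition bifiltration : diagram (J R).
refine (@Diagram (J R) (fun x => realization (T x))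
  (fun x y h => realization_inclusion (hT h))
  (fun x y h => @realization_inclusion_continuous _ _ (hT h)) _ _).
- by move=> x h p; apply: val_inj.
- by move=> x y z h k l p; apply: val_inj.
Defined.

End Realization.

Section DegreeComplex.
Variables (R : realType) (V : choiceType).
Local Open Scope fset_scope.

Definition degree (T : complex V) (x : V) : nat :=
  #|` [fset y in \bigcup_(s <- simplices T) s
        | (y != x) && ([fset x; y] \in simplices T)] |.

Lemma degree_mono (T T' : complex V) x :
  simplices T `<=` simplices T' -> (degree T x <= degree T' x)%N.
Proof.
move=> /fsubsetP TT'; apply: fsubset_leq_card; apply/fsubsetP => y.
rewrite !inE => /andP[/bigfcupP[s /andP[sT _] ys] /andP[-> /TT' ->]].
by rewrite !andbT; apply/bigfcupP; exists s => //; rewrite TT'.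
Qed.

(* Degrees are taken in the 1-skeleton of T, not of S. *)
Definition degree_subcomplex (T : complex V) (k : R) (S : complex V) : Prop :=
  simplices S `<=` simplices T /\
  forall x, [fset x] \in simplices S -> k - 1 <= (degree T x)%:R.

Definition degree_complex_simplices (T : complex V) (k : R) :
    {fset {fset V}} :=
  [fset s in simplices T
    | `[< exists2 S, degree_subcomplex T k S & s \in simplices S >]].

Lemma degree_complex_neq0 T k : fset0 \notin degree_complex_simplices T k.
Proof. by rewrite !inE (negbTE (simplex_neq0 T)). Qed.

Lemma degree_complex_closed T k (s t : {fset V}) :
  s \in degree_complex_simplices T k -> t `<=` s -> t != fset0 ->
  t \in degree_complex_simplices T k.
Proof.
rewrite !inE => /andP[sT /asboolP[S TS sS]] ts t0; apply/andP; split.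
  exact: simplex_closed sT ts t0.
by apply/asboolP; exists S => //; exact: simplex_closed sS ts t0.
Qed.

(* The maximum subcomplex, obtained as a union; see [degree_complexP]. *)
Definition degree_complex (T : complex V) (k : R) : complex V :=
  Complex (degree_complex_neq0 T k) (@degree_complex_closed T k).

Lemma degree_complexP T k :
  degree_subcomplex T k (degree_complex T k) /\
  forall S, degree_subcomplex T k S ->
    simplices S `<=` simplices (degree_complex T k).
Proof.
split; first split.
- by apply/fsubsetP => s; rewrite !inE => /andP[].
- by move=> x; rewrite !inE => /andP[_ /asboolP[S [_ hS] xS]]; exact: hS.
- move=> S hS; apply/fsubsetP => s sS; rewrite !inE.
  rewrite (fsubsetP hS.1)//=.
  by apply/asboolP; exists S.
Qed.

Lemma degree_complex_mono T T' k k' :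
  simplices T `<=` simplices T' -> k' <= k ->
  simplices (degree_complex T k) `<=` simplices (degree_complex T' k').
Proof.
move=> TT' kk'; have [[DT Ddeg] _] := degree_complexP T k.
apply: (degree_complexP T' k').2; split; first exact: fsubset_trans DT TT'.
move=> x /Ddeg; rewrite -(lerD2r (-1)) in kk' => /(le_trans kk') /le_trans.
by apply; rewrite ler_nat degree_mono.
Qed.

End DegreeComplex.

Section CechRips.
Variables (R : realType) (Z : metricType R).
Local Open Scope fset_scope.
Implicit Types X s : {fset Z}.

(* For r > 0 the vertex set of these complexes is all of X. *)
Definition cech_simplices X (r : R) : {fset {fset Z}} :=
  [fset s in fpowerset X | (s != fset0) &&
    `[< (\bigcap_(x in [set` s]) ball x r !=set0)%classic >]].

Lemma cech_neq0 X r : fset0 \notin cech_simplices X r.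
Proof. by rewrite !inE eqxx andbF. Qed.

Lemma cech_closed X r (s t : {fset Z}) :
  s \in cech_simplices X r -> t `<=` s -> t != fset0 ->
  t \in cech_simplices X r.
Proof.
rewrite !inE !fpowersetE => /and3P[sX _ /asboolP[z hz]] ts ->.
rewrite (fsubset_trans ts sX) /=; apply/asboolP; exists z => x /= xt.
by apply: hz; exact: (fsubsetP ts).
Qed.

Definition cech X r : complex Z :=
  Complex (cech_neq0 X r) (@cech_closed X r).

Definition rips_simplices X (r : R) : {fset {fset Z}} :=
  [fset s in fpowerset X | (s != fset0) &&
    `[< forall x y, x \in s -> y \in s -> x != y -> mdist x y < 2 * r >]].

Lemma rips_neq0 X r : fset0 \notin rips_simplices X r.
Proof. by rewrite !inE eqxx andbF. Qed.

Lemma rips_closed X r (s t : {fset Z}) :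
  s \in rips_simplices X r -> t `<=` s -> t != fset0 ->
  t \in rips_simplices X r.
Proof.
rewrite !inE !fpowersetE => /and3P[sX _ /asboolP hs] ts ->.
rewrite (fsubset_trans ts sX) /=; apply/asboolP => x y xt yt.
by apply: hs; exact: (fsubsetP ts).
Qed.

Definition rips X r : complex Z :=
  Complex (rips_neq0 X r) (@rips_closed X r).

Lemma cech_mono X r r' : r <= r' ->
  simplices (cech X r) `<=` simplices (cech X r').
Proof.
move=> rr'; apply/fsubsetP => s; rewrite !inE.
move=> /and3P[-> -> /asboolP[z hz]] /=; apply/asboolP; exists z => x /= xs.
exact: le_ball rr' _ (hz x xs).
Qed.

Lemma rips_mono X r r' : r <= r' ->
  simplices (rips X r) `<=` simplices (rips X r').
Proof.
move=> rr'; apply/fsubsetP => s; rewrite !inE.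
move=> /and3P[-> -> /asboolP hs] /=; apply/asboolP => x y xs ys xy.
by apply: (lt_le_trans (hs x y xs ys xy)); rewrite ler_pM2l.
Qed.

Definition degree_cech_complex X (x : J R) : complex Z :=
  degree_complex (cech X (sval x).2) ((sval x).1 * #|` X|%:R).

Definition degree_rips_complex X (x : J R) : complex Z :=
  degree_complex (rips X (sval x).2) ((sval x).1 * #|` X|%:R).

Lemma degree_cech_mono X (x y : J R) : hom x y ->
  simplices (degree_cech_complex X x) `<=` simplices (degree_cech_complex X y).
Proof.
move=> /andP[k r]; apply: degree_complex_mono; first exact: cech_mono.
exact: ler_wpM2r.
Qed.

Lemma degree_rips_mono X (x y : J R) : hom x y ->
  simplices (degree_rips_complex X x) `<=` simplices (degree_rips_complex X y).
Proof.
move=> /andP[k r]; apply: degree_complex_mono; first exact: rips_mono.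
exact: ler_wpM2r.
Qed.

Definition degree_cech X : diagram (J R) := bifiltration (@degree_cech_mono X).

Definition degree_rips_on X : diagram (J R) :=
  bifiltration (@degree_rips_mono X).

End CechRips.

(* Meaningful only when X is finite; otherwise [points X] is empty. *)
Definition points (R : realType) (X : metricType R) : {fset X} :=
  fset_set [set: X].

Definition degree_rips (R : realType) (X : metricType R) : diagram (J R) :=
  degree_rips_on (points X).

(* For the empty collection s = [::] the intersection is Z itself; balls of
   non-positive radius are empty. *)
Definition good (R : realType) (Z : metricType R) :=
  forall s : seq (Z * R),
    let A := [set z : Z | forall b, b \in s -> ball b.1 b.2 z] in
    A = set0 \/ contractible R (set_type A).

Definition borel (R : realType) (Z : pmetricType R) :=
  g_sigma_algebraType (@open Z).

HB.instance Definition _ (R : realType) (Z : pmetricType R) :=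
  Measurable.on (borel Z).

Lemma borel_closed (R : realType) (Z : pmetricType R) (A : set Z) :
  closed A -> measurable (A : set (borel Z)).
Proof.
move=> cA; rewrite -[A]setCK; apply: (@measurableC _ (borel Z)).
by apply: sub_sigma_algebra; exact: closed_openC.
Qed.

Section UniformMeasure.
Variables (R : realType) (Z : pmetricType R) (X : {fset Z}).
Local Open Scope ereal_scope.

Definition nu (A : set (borel Z)) : \bar R :=
  ((#|` fset_set (A `&` [set` X]) |)%:R / (#|` X |)%:R)%R%:E.

Let measurable_X : measurable ([set` X] : set (borel Z)).
Proof.
have Z1 : accessible_space Z.
  by apply: hausdorff_accessible; exact: (@metric_hausdorff R Z).
apply: borel_closed; have h := accessible_finite_set_closed.1 Z1.
by apply: h; exact: finite_fset.
Qed.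

Let m : {measure set (borel Z) -> \bar R} :=
  mscale ((#|` X |%:R^-1)%:nng)%R (mrestr counting measurable_X).

Let nuE : nu = m :> (set (borel Z) -> \bar R).
Proof.
apply/funext => A; rewrite /nu /m /= /mscale /= /mrestr /counting asboolT.
  by rewrite EFinM muleC.
exact: finite_setIr.
Qed.

Let nu0 : nu set0 = 0.
Proof. by rewrite nuE measure0. Qed.

Let nu_ge0 A : 0 <= nu A.
Proof. by rewrite nuE. Qed.

Let nu_semi_sigma_additive : semi_sigma_additive nu.
Proof. by rewrite nuE; exact: measure_semi_sigma_additive. Qed.

HB.instance Definition _ := isMeasure.Build _ _ _ nu
  nu0 nu_ge0 nu_semi_sigma_additive.

End UniformMeasure.

Definition mu (R : realType) (X : pmetricType R) :
    {measure set (borel X) -> \bar R} :=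
  nu (points X).

Lemma muE (R : realType) (X : pmetricType R) (A : set (borel X)) :
  finite_set [set: X] ->
  mu X A = ((#|` fset_set A |)%:R / (#|` fset_set [set: X] |)%:R)%:E.
Proof.
move=> fX; rewrite /mu /points /= /nu (fset_setK fX).
by rewrite (_ : A `&` _ = A)//; exact: setIT.
Qed.

Section Prohorov.
Variable R : realType.
Local Open Scope ereal_scope.

Definition thickening (Z : pmetricType R) (A : set Z) (d : R) : set Z :=
  [set z | exists2 a, A a & (mdist z a < d)%R].

Definition prohorov (Z : pmetricType R)
    (m n : {measure set (borel Z) -> \bar R}) : \bar R :=
  ereal_sup [set ereal_inf [set d%:E | d in [set d : R |
      [/\ (0 <= d)%R,
          m A <= n (thickening A d) + d%:E &
          n A <= m (thickening A d) + d%:E]]]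
    | A in [set A : set Z | closed A]].

Record isometric_embedding (X W : metricType R) := IsometricEmbedding {
  embedding :> X -> W;
  embedding_isometric : forall x y,
    mdist (embedding x) (embedding y) = mdist x y }.

Lemma isometric_embedding_measurable (X W : pmetricType R)
    (f : isometric_embedding X W) :
  measurable_fun [set: borel X] (f : borel X -> borel W).
Proof.
apply: (@measurability _ _ _ (borel W) _ _ (@open W)) => //.
move=> _ [U oU <-]; rewrite setTI.
apply: sub_sigma_algebra.
apply: open_comp oU => x _; apply/cvg_ballP => e e0.
near=> y; rewrite ballEmdist /= embedding_isometric.
have : ball x e y by near: y; exact: nbhsx_ballx.
by rewrite ballEmdist.
Unshelve. all: by end_near. Qed.

Section Pushforward.
Variables (X W : pmetricType R) (f : isometric_embedding X W).
Variable m : {measure set (borel X) -> \bar R}.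

Definition embedded_measure : set (borel W) -> \bar R :=
  pushforward m (f : borel X -> borel W).

Let mf A : measurable A -> measurable ((f : borel X -> borel W) @^-1` A).
Proof.
by move=> mA; rewrite -[X in measurable X]setTI;
  exact: isometric_embedding_measurable.
Qed.

Let embedded_measure0 : embedded_measure set0 = 0.
Proof. by rewrite /embedded_measure /pushforward preimage_set0 measure0. Qed.

Let embedded_measure_ge0 A : 0 <= embedded_measure A.
Proof. by rewrite /embedded_measure /pushforward. Qed.

Let embedded_measure_semi_sigma_additive :
  semi_sigma_additive embedded_measure.
Proof.
move=> F mF tF mUF; rewrite /embedded_measure /pushforward preimage_bigcup.
apply: measure_semi_sigma_additive.
- by move=> n; exact: mf.
- apply/trivIsetP => /= i j _ _ ij; rewrite -preimage_setI.
  by move/trivIsetP : tF => /(_ _ _ _ _ ij) ->//; rewrite preimage_set0.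
- by rewrite -preimage_bigcup; exact: mf.
Qed.

HB.instance Definition _ := isMeasure.Build _ _ _ embedded_measure
  embedded_measure0 embedded_measure_ge0 embedded_measure_semi_sigma_additive.

End Pushforward.

Definition gromov_prohorov (X Y : pmetricType R)
    (m : {measure set (borel X) -> \bar R})
    (n : {measure set (borel Y) -> \bar R}) : \bar R :=
  ereal_inf [set e | exists (W : pmetricType R)
      (f : isometric_embedding X W) (g : isometric_embedding Y W),
    e = prohorov (embedded_measure f m) (embedded_measure g n)].

End Prohorov.

(* Main.v *)
(* Put five points near 0 and five points near 3L on the real line, and call
   this set Y; let X be Y together with the points L and 2L. The uniform
   measures on X and Y are at Prohorov distance at most 1/6. Each added point has a whole cluster
   within distance about L, hence large degree, so the complexes of X become
   connected at radius about L/2, while the complexes of Y stay disconnected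
   up to radius about 3L/2 although their vertices already have large degree
   at small radius. A homotopy interleaving factors, on path components, a
   structure map of Y from radius r to about c^2 r through a complex of X at
   radius about c r; for c < 3 one can choose r with c r about L/2, so that the
   middle complex is connected and the last one is not. *)

Require Import Defs.
From HB Require Import structures.
From mathcomp Require Import all_boot all_order all_algebra finmap.
From mathcomp Require Import all_classical all_reals all_analysis.
From mathcomp Require Import ring lra.
Import Order.TTheory GRing.Theory Num.Theory.
Import numFieldNormedType.Exports.
Set Implicit Arguments.
Unset Strict Implicit.
Unset Printing Implicit Defensive.

Local Open Scope classical_set_scope.
Local Open Scope ring_scope.

(** * Paths and path components *)

Section Paths.
Variable R : realType.
Implicit Type T : topologicalType.

(** Retraction of the line onto the unit interval: it extends a path from the subtype [unitI] to all
    of [R]. *)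
Definition clamp (t : R) : R := Num.min 1 (Num.max 0 t).

Lemma clamp_unitI t : `[0, 1]%classic (clamp t).
Proof. by rewrite /= in_itv /= le_min ge_min le_max !lexx ler01. Qed.

Definition unitI_proj (t : R) : unitI R := SigSub (mem_set (clamp_unitI t)).

Lemma unitI_proj_continuous : continuous unitI_proj.
Proof.
apply: continuous_comp_initial => t.
apply: (@continuous_min R R (cst 1) (Num.max 0)); first exact: cvg_cst.
by apply: (@continuous_max R R (cst 0) id) => //; exact: cvg_cst.
Qed.

Lemma set_val_continuous (S : topologicalType) (A : set S) :
  continuous (set_val : set_type A -> S).
Proof. by move=> x; exact: (@initial_continuous _ _ set_val). Qed.

(** Paths defined on the whole line can be reparametrized and glued without leaving a subtype, and
    the intermediate value theorem applies to them directly. *)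
Lemma joinedP T (x y : T) : joined R x y <->
  exists p : R -> T, [/\ continuous p, p 0 = x & p 1 = y].
Proof.
split=> [[p [cp p0 p1]]|[p [cp p0 p1]]].
  exists (p \o unitI_proj); split.
  - move=> t; apply: continuous_comp; last exact: cp.
    exact: unitI_proj_continuous.
  - by apply: p0; change (clamp 0 = 0); rewrite /clamp maxxx min_r ?ler01.
  - by apply: p1; change (clamp 1 = 1); rewrite /clamp max_r ?ler01// min_l.
exists (p \o set_val); split.
- by move=> t; apply: continuous_comp; [exact: set_val_continuous|exact: cp].
- by move=> t /= ->.
- by move=> t /= ->.
Qed.

Lemma joined_sym T (x y : T) : joined R x y -> joined R y x.
Proof.
move=> /joinedP[p [cp p0 p1]]; apply/joinedP.
exists (p \o (fun t => 1 - t)); split.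
- move=> t; apply: continuous_comp; last exact: cp.
  by apply: cvgB; [exact: cvg_cst|exact: cvg_id].
- by rewrite /= subr0.
- by rewrite /= subrr.
Qed.

(** Concatenation at double speed: the two halves are continuous on the closed half-lines cut at
    [2^-1], where both take the value [y]. *)
Lemma joined_trans T (y x z : T) :
  joined R x y -> joined R y z -> joined R x z.
Proof.
move=> /joinedP[p [cp p0 p1]] /joinedP[q [cq q0 q1]]; apply/joinedP.
pose r t : T := if t <= 2^-1 then p (2 * t) else q (2 * t - 1).
exists r; split; last 2 first.
- by rewrite /r invr_ge0 ler0n mulr0.
- rewrite /r ifF; last by apply/negbTE; rewrite -ltNge; lra.
  by rewrite (_ : 2 * 1 - 1 = 1 :> R)//; lra.
have c2 : continuous (fun t : R => 2 * t).
  by move=> t; apply: cvgM; [exact: cvg_cst|exact: cvg_id].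
have c21 : continuous (fun t : R => 2 * t - 1).
  by move=> t; apply: cvgB; [exact: c2|exact: cvg_cst].
have cpr : continuous (p \o (fun t => 2 * t)).
  by move=> t; apply: continuous_comp; [exact: c2|exact: cp].
have cqr : continuous (q \o (fun t => 2 * t - 1)).
  by move=> t; apply: continuous_comp; [exact: c21|exact: cq].
apply/continuous_subspace_setT.
have -> : [set: R] = `]-oo, 2^-1] `|` `[2^-1, +oo[.
  apply/esym/seteqP; split=> // t _; rewrite /= !in_itv /= andbT.
  by apply/orP; exact: le_total.
apply: withinU_continuous; [exact: interval_closed|exact: interval_closed| |].
- apply: subspace_eq_continuous (continuous_subspaceT cpr) => t.
  by rewrite inE /= in_itv /= => t2; change (p (2 * t) = r t); rewrite /r t2.
- apply: subspace_eq_continuous (continuous_subspaceT cqr) => t.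
  rewrite inE /= in_itv /= andbT => t2.
  change (q (2 * t - 1) = r t); rewrite /r; case: ifP => // t2'.
  have -> : t = 2^-1 by apply/eqP; rewrite eq_le t2 t2'.
  by rewrite divff// subrr p1 q0.
Qed.

Lemma joined_continuous T T' (f : T -> T') x y :
  continuous f -> joined R x y -> joined R (f x) (f y).
Proof.
move=> cf [p [cp p0 p1]]; exists (f \o p); split.
- by move=> t; apply: continuous_comp; [exact: cp|exact: cf].
- by move=> t /p0 /= ->.
- by move=> t /p1 /= ->.
Qed.

(** Otherwise the intermediate value theorem would produce the value [2^-1] along the path. *)
Lemma joined_two_valued T (f : T -> R) x y : continuous f ->
  (forall z, f z = 0 \/ f z = 1) -> joined R x y -> f x = f y.
Proof.
move=> cf f01 /joinedP[p [cp <- <-]].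
have cg : {within `[0, 1], continuous (f \o p)}.
  apply: continuous_subspaceT => t.
  by apply: continuous_comp; [exact: cp|exact: cf].
have := IVT (@ler01 R) cg (v := 2^-1).
case: (f01 (p 0)) (f01 (p 1)) => /= -> [] -> //.
- rewrite /= min_l ?ler01// max_r ?ler01// => /(_ _)[|t _ ft].
    by rewrite invr_ge0 ler0n invf_le1 ?ler1n.
  by case: (f01 (p t)); rewrite ft => h; exfalso; lra.
- rewrite /= min_r ?ler01// max_l ?ler01// => /(_ _)[|t _ ft].
    by rewrite invr_ge0 ler0n invf_le1 ?ler1n.
  by case: (f01 (p t)); rewrite ft => h; exfalso; lra.
Qed.

End Paths.

(** * A homotopy invariant of structure maps on path components *)

Section Collapse.
Variable R : realType.

(** Triviality on path components, phrased with paths to avoid quotients. For [s = p] the structure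
    map is the identity, so the condition says that [F p] is empty or path-connected. *)
Definition collapses (C : thin_category) (F : diagram C) (p s : C) :=
  forall (h : Defs.hom p s) (x y : F p),
    joined R (map_of F h x) (map_of F h y).

(** Only the bijection on path components enters: surjectivity at [p] carries the property from [F]
    to [G], injectivity at [s] carries it back. *)
Lemma collapses_weak_equivalence (C : thin_category) (F G : diagram C) p s :
  objectwise_weak_equivalence R F G -> collapses F p s <-> collapses G p s.
Proof.
move=> [eta we]; split=> col h x y.
  have [_ _ sur _ _] := we p.
  have [x' xx'] := sur x; have [y' yy'] := sur y.
  have lift z z' : joined R (eta p z') z ->
      joined R (map_of G h z) (eta s (map_of F h z')).
    move=> zz'; apply: joined_sym.
    rewrite [eta s _](naturality eta h z').
    by apply: joined_continuous zz'; exact: map_of_continuous.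
  apply: joined_trans (lift _ _ xx') _.
  apply: joined_trans (joined_sym (lift _ _ yy')).
  by apply: joined_continuous (col h x' y'); exact: component_continuous.
have [_ refl _ _ _] := we s.
apply: refl; rewrite [eta s _](naturality eta h x).
rewrite [eta s (_ y)](naturality eta h y); exact: col.
Qed.

Lemma collapses_weakly_equivalent (C : thin_category) (F G : diagram C) p s :
  weakly_equivalent R F G -> collapses F p s <-> collapses G p s.
Proof.
elim=> {F G}.
- by move=> F G; exact: collapses_weak_equivalence.
- by move=> F; exact: iff_refl.
- by move=> F G _; exact: iff_sym.
- by move=> F G H _ FG _ GH; exact: iff_trans FG GH.
Qed.

(* In the interleaved pair, G q -> G s factors through F p. *)
Lemma interleaved_collapses (gamma kappa : forward_shift R)
    (F G : diagram (J R)) (p q s : J R) :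
  homotopy_interleaved2 gamma kappa F G ->
  le2 (kappa (sval q)) (sval p) -> le2 (gamma (sval p)) (sval s) ->
  collapses F p p -> collapses G q s.
Proof.
move=> [F' [G' [wF wG [H [HF HG]]]]] qp ps.
move=> /(collapses_weakly_equivalent p p wF) col.
apply/(collapses_weakly_equivalent q s wG); rewrite -{}HF -{}HG in col *.
move=> h x y.
pose C : thin_category := interleaving_category gamma kappa.
have h1 : @Defs.hom C (q, true) (p, false) := qp.
have h2 : @Defs.hom C (p, false) (s, true) := ps.
rewrite [map_of _ h x](map_of_comp H h1 h2).
rewrite [map_of _ h y](map_of_comp H h1 h2) /=.
apply: joined_continuous; first exact: map_of_continuous.
(* The collapse of [F p] is used for the identity arrow of [p], whose structure map [map_of_id]
   removes. *)
have hp : @Defs.hom (J R) p p by exact: hom_refl.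
have := col hp (map_of H h1 x) (map_of H h1 y).
by rewrite /= !map_of_id.
Qed.

End Collapse.

(** * Path components of geometric realizations *)

Section RealizationPaths.
Variables (R : realType) (V : choiceType).
Local Open Scope fset_scope.
Local Open Scope ring_scope.
Implicit Types (T : complex V) (p q : {ptws V -> R}).

Lemma simplex_nonempty T (s : {fset V}) : s \in simplices T -> s != fset0.
Proof. by apply: contraTneq => ->; exact: simplex_neq0. Qed.

Lemma sum_support (s W : {fset V}) (f : V -> R) : s `<=` W ->
  (forall x, x \notin s -> f x = 0) -> \sum_(x <- s) f x = \sum_(x <- W) f x.
Proof. by move=> sW f0; apply: big_fset_incl => // x _ /f0. Qed.

(** Allowing coordinates to vanish on [s] makes membership stable under convex combinations; the
    true support is a face of [s], hence again a simplex. *)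
Lemma realization_setP T p : realization_set T p <->
  exists2 s : {fset V}, s \in simplices T &
    [/\ forall x, 0 <= p x, forall x, x \notin s -> p x = 0 &
        \sum_(x <- s) p x = 1].
Proof.
split=> -[s sT [p0 ps p1]].
  by exists s => //; split=> // x; rewrite -ps => /negPn/eqP.
pose s' := [fset x in s | p x != 0].
have s's : s' `<=` s by apply/fsubsetP => x; rewrite !inE => /andP[].
have ps' x : x \notin s' -> p x = 0.
  rewrite !inE negb_and negbK => /orP[/ps//|/eqP//].
have E : \sum_(x <- s') p x = 1 by rewrite (sum_support s's ps').
have s'T : s' \in simplices T.
  apply: simplex_closed sT s's _; apply/eqP => s0.
  by move: E; rewrite s0 big_seq_fset0 => /esym/eqP; rewrite oner_eq0.
exists s' => //; split=> // x; rewrite !inE.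
by have [//|/ps ->] := boolP (x \in s); rewrite eqxx.
Qed.

Definition vertex_fun (v : V) : {ptws V -> R} := fun x => (x == v)%:R.

Lemma vertex_subproof T v : [fset v] \in simplices T ->
  realization_set T (vertex_fun v).
Proof.
move=> vT; apply/realization_setP; exists [fset v] => //; split.
- by move=> x; rewrite /vertex_fun ler0n.
- by move=> x; rewrite inE /vertex_fun => /negbTE ->.
- by rewrite big_seq_fset1 /vertex_fun eqxx.
Qed.

Definition vertex T v (vT : [fset v] \in simplices T) : realization R T :=
  SigSub (mem_set (vertex_subproof vT)).

Lemma vertexE T v (vT : [fset v] \in simplices T) x :
  set_val (vertex vT) x = (x == v)%:R.
Proof. by []. Qed.

Lemma ptws_continuous (S : topologicalType) (f : S -> {ptws V -> R}) :
  (forall x, continuous (fun s => f s x)) -> continuous f.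
Proof.
move=> cf s; apply/cvg_sup => x.
exact: (@continuous_comp_initial _ _ _ (fun g : {ptws V -> R} => g x) f (cf x)).
Qed.

(** The straight segment from [p] to [q] stays in the closed simplex [s]. *)
Lemma joined_simplex T (s : {fset V}) (p q : realization R T) :
  s \in simplices T -> (forall x, x \notin s -> set_val p x = 0) ->
  (forall x, x \notin s -> set_val q x = 0) -> joined R p q.
Proof.
move=> sT ps qs.
(* The coordinates of [r] sum to 1 over its support [u]; both this sum and the one over [s] equal
   the sum over their union. *)
have sum1 (r : realization R T) : (forall x, x \notin s -> set_val r x = 0) ->
    \sum_(x <- s) set_val r x = 1.
  move=> rs; have [u uT [r0 ru r1]] := set_valP r.
  rewrite (sum_support (fsubsetUl s u) rs).
  rewrite -(sum_support (fsubsetUr s u)) // => x.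
  by rewrite -ru => /negPn/eqP.
pose f (t : unitI R) : {ptws V -> R} :=
  fun x => (1 - set_val t) * set_val p x + set_val t * set_val q x.
have fT t : realization_set T (f t).
  have /andP[t0 t1] : 0 <= set_val t <= 1.
    by have := set_valP t; rewrite /= in_itv.
  have p0 x : 0 <= set_val p x by have [? _ [p0 _ _]] := set_valP p; exact: p0.
  have q0 x : 0 <= set_val q x by have [? _ [q0 _ _]] := set_valP q; exact: q0.
  apply/realization_setP; exists s => //; split.
  - by move=> x; apply: addr_ge0; apply: mulr_ge0 => //; rewrite subr_ge0.
  - by move=> x xs; rewrite /f ps// qs// !mulr0 addr0.
  - by rewrite /f big_split /= -!mulr_sumr !sum1// !mulr1 subrK.
exists (fun t => SigSub (mem_set (fT t))); split.
- apply: continuous_comp_initial; apply: ptws_continuous => x t.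
  have ct : {for t, continuous (set_val : unitI R -> R)}.
    exact: set_val_continuous.
  apply: (@continuousD R R^o (unitI R)
    (fun t => (1 - set_val t) * set_val p x)
    (fun t => set_val t * set_val q x)); apply: continuousM.
  - apply: (@continuousB R R^o (unitI R) (cst 1)) => //.
    exact: cst_continuous.
  - exact: cst_continuous.
  - exact: ct.
  - exact: cst_continuous.
- move=> t t0; apply: val_inj; apply/funext => x.
  by rewrite /= /f t0 subr0 mul1r mul0r addr0.
- move=> t t1; apply: val_inj; apply/funext => x.
  by rewrite /= /f t1 subrr mul1r mul0r add0r.
Qed.

Lemma joined_edge T v w (vT : [fset v] \in simplices T)
    (wT : [fset w] \in simplices T) :
  [fset v; w] \in simplices T -> joined R (vertex vT) (vertex wT).
Proof.
move=> vwT; apply: joined_simplex vwT _ _ => x.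
  by rewrite !inE negb_or vertexE => /andP[/negbTE ->].
by rewrite !inE negb_or vertexE => /andP[_ /negbTE ->].
Qed.

Lemma joined_some_vertex T (p : realization R T) :
  exists v (vT : [fset v] \in simplices T), joined R p (vertex vT).
Proof.
have [s sT [p0 ps _]] := set_valP p.
have /fset0Pn[v vs] := simplex_nonempty sT.
have vT : [fset v] \in simplices T.
  apply: simplex_closed sT _ _; first by rewrite fsub1set.
  by apply/fset0Pn; exists v; rewrite inE.
exists v, vT; apply: joined_simplex sT _ _ => x xs.
  by move: xs; rewrite -ps => /negPn/eqP.
rewrite vertexE; case: eqP => // xv.
by rewrite xv vs in xs.
Qed.

(** Every point reaches a vertex of its carrier, and every vertex reaches [x], directly or through
    [y]. For [v = x] the set [[fset v; x]] is the singleton, so the domination hypothesis is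
    harmless at the ends of the edge. *)
Lemma joined_of_dominating_edge T x y : [fset x; y] \in simplices T ->
  (forall v, [fset v] \in simplices T ->
    [fset v; x] \in simplices T \/ [fset v; y] \in simplices T) ->
  forall p q : realization R T, joined R p q.
Proof.
move=> xyT dom.
have sub1 u : u \in [fset x; y] -> [fset u] \in simplices T.
  move=> uxy; apply: simplex_closed xyT _ _; first by rewrite fsub1set.
  by apply/fset0Pn; exists u; rewrite inE.
have xT := sub1 x (fset21 x y); have yT := sub1 y (fset22 x y).
have tox (p : realization R T) : joined R p (vertex xT).
  have [v [vT pv]] := joined_some_vertex p; apply: (joined_trans pv).
  have [vx|vy] := dom v vT; first exact: joined_edge.
  apply: (@joined_trans _ _ (vertex yT)); first exact: joined_edge.
  by apply: joined_sym; exact: joined_edge.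
by move=> p q; exact: joined_trans (tox p) (joined_sym (tox q)).
Qed.

(** The total barycentric weight carried by [A] is continuous, and it is 0 or 1 everywhere because
    no simplex meets both [A] and its complement. *)
Lemma not_joined_separated T (A : pred V) a b
    (aT : [fset a] \in simplices T) (bT : [fset b] \in simplices T) :
  (forall s, s \in simplices T -> {in s &, forall x y, A x = A y}) ->
  A a -> ~~ A b -> ~ joined R (vertex aT) (vertex bT).
Proof.
move=> sep Aa Ab.
pose W := \bigcup_(s <- simplices T) s.
pose f (p : realization R T) : R := \sum_(x <- W) (A x)%:R * set_val p x.
have cf : continuous f.
  move=> p.
  apply: (@cvg_big R^o V +%R 0 xpredT (@add_continuous R^o) _ (nbhs p) W
    (fun x (q : realization R T) => (A x)%:R * set_val q x)
    (fun x => (A x)%:R * set_val p x)) => x _.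
  apply: (@continuousM R (realization R T) (cst (A x)%:R)).
    exact: cst_continuous.
  apply: (@continuous_comp _ _ _ set_val (fun g : {ptws V -> R} => g x)).
    exact: set_val_continuous.
  exact: (@proj_continuous V (fun=> R) x).
have f01 (p : realization R T) : f p = 0 \/ f p = 1.
  have [s sT [p0 ps p1]] := set_valP p.
  have /fset0Pn[v vs] := simplex_nonempty sT.
  have pE x : x \notin s -> set_val p x = 0 by rewrite -ps => /negPn/eqP.
  have sW : s `<=` W := @bigfcup_sup _ _ _ s xpredT id sT isT.
  have pW : \sum_(x <- W) set_val p x = 1.
    by rewrite -(sum_support sW).
  have fE : f p = (A v)%:R * \sum_(x <- W) set_val p x.
    rewrite mulr_sumr; apply: eq_bigr => x _.
    have [xs|] := boolP (x \in s); first by rewrite (sep s sT x v).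
    by move=> /pE ->; rewrite !mulr0.
  by rewrite fE pW mulr1; case: (A v); [right|left].
have fv v (vT : [fset v] \in simplices T) : f (vertex vT) = (A v)%:R.
  rewrite /f -(@sum_support [fset v]).
  - by rewrite big_seq_fset1 vertexE eqxx mulr1.
  - exact: (@bigfcup_sup _ _ _ [fset v] xpredT id).
  - by move=> x; rewrite inE vertexE => /negbTE ->; rewrite mulr0.
move=> /(joined_two_valued cf f01); rewrite !fv Aa (negbTE Ab) => /eqP.
by rewrite oner_eq0.
Qed.

End RealizationPaths.

(* The map S q -> S s factors up to homotopy through the connected T p, but
   [a] and [b] lie in different components of S s. *)
Lemma not_homotopy_interleaved (R : realType) (V W : choiceType)
    (gamma : forward_shift R) (T : J R -> complex V) (S : J R -> complex W)
    hT hS (p q s : J R) (x y : V) (a b : W) (A : pred W) :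
  le2 (gamma (sval q)) (sval p) -> le2 (gamma (sval p)) (sval s) ->
  [fset x; y]%fset \in simplices (T p) ->
  (forall v, [fset v]%fset \in simplices (T p) ->
    [fset v; x]%fset \in simplices (T p) \/
    [fset v; y]%fset \in simplices (T p)) ->
  [fset a]%fset \in simplices (S q) -> [fset b]%fset \in simplices (S q) ->
  (forall t, t \in simplices (S s) -> {in t &, forall x y, A x = A y}) ->
  A a -> ~~ A b ->
  ~ homotopy_interleaved gamma
      (@bifiltration R V T hT) (@bifiltration R W S hS).
Proof.
move=> qp ps xy dom aq bq sep Aa Ab.
have qs : @Defs.hom (J R) q s.
  apply: (le2_trans (shift_ge gamma q)); apply: (le2_trans qp).
  exact: le2_trans (shift_ge gamma p) ps.
move=> /interleaved_collapses/(_ qp ps) col.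
have {}col := col (fun _ _ _ => joined_of_dominating_edge xy dom _ _).
have := col qs (vertex R aq) (vertex R bq).
have as_ := fsubsetP (hS _ _ qs) _ aq; have bs := fsubsetP (hS _ _ qs) _ bq.
have E v (vq : [fset v]%fset \in simplices (S q))
    (vs : [fset v]%fset \in simplices (S s)) :
    map_of (bifiltration hS) qs (vertex R vq) = vertex R vs.
  exact: val_inj.
rewrite (E a aq as_) (E b bq bs); exact: not_joined_separated sep Aa Ab.
Qed.

(** * Vertex degrees and degree subcomplexes *)

Section DegreeBounds.
Variables (R : realType) (V : choiceType).
Local Open Scope fset_scope.
Local Open Scope ring_scope.

(** The successor allows for [v] being one of the [f j]: then [[fset v; f j]] is a mere vertex and
    does not count towards the degree. *)
Lemma degree_lower_bound (T : complex V) v m (f : 'I_m -> V) : injective f ->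
  (forall j, [fset v; f j] \in simplices T) -> (m <= (degree T v).+1)%N.
Proof.
move=> inj_f vf.
pose N := [fset f j | j in 'I_m].
have -> : m = #|` N| by rewrite card_imfset //= -cardE card_ord.
rewrite (cardfsD1 v) -add1n leq_add ?leq_b1//.
apply: fsubset_leq_card; apply/fsubsetP => y; rewrite !inE /=.
move=> /andP[-> /imfsetP[j _ ->]]; rewrite vf !andbT.
apply/bigfcupP; exists [fset v; f j]; rewrite ?vf//; exact: fset22.
Qed.

Lemma degree_complex_full (T : complex V) (k : R) s :
  (forall v, [fset v] \in simplices T -> k - 1 <= (degree T v)%:R) ->
  s \in simplices T -> s \in simplices (degree_complex T k).
Proof.
move=> deg sT; apply: (fsubsetP ((degree_complexP T k).2 T _) _ sT).
by split.
Qed.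

Lemma degree_complex_sub (T : complex V) (k : R) s :
  s \in simplices (degree_complex T k) -> s \in simplices T.
Proof. exact: (fsubsetP (degree_complexP T k).1.1). Qed.

End DegreeBounds.

(** * The twelve points on the line and their distances *)

Section LinePoints.
Variables (R : realType) (L : R).

(* Two clusters of five points at mutual distance about [3 L]; the two extra
   points of index 10 and 11 cut this gap into three steps of about [L]. *)
Definition line_point (i : nat) : R :=
  if (i < 5)%N then i%:R else
  if (i < 10)%N then 3 * L + (i - 5)%:R else (i - 9)%:R * L.

Lemma line_point_left i : (i < 5)%N -> 0 <= line_point i <= 4.
Proof. by move=> i5; rewrite /line_point i5 ler0n ler_nat. Qed.

Lemma line_point_right i : (5 <= i < 10)%N ->
  3 * L <= line_point i <= 3 * L + 4.
Proof.
move=> /andP[i5 i10]; rewrite /line_point ltnNge i5 i10 /= lerDl ler0n lerD2l.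
by rewrite ler_nat leq_subLR -ltnS.
Qed.

Lemma index_cases i : (i < 12)%N ->
  [\/ (i < 5)%N, (5 <= i < 10)%N, i = 10%N | i = 11%N].
Proof.
move=> i12; have [|i5] := ltnP i 5; first by constructor 1.
have [|i10] := ltnP i 10; first by constructor 2.
have [|i10'] := eqVneq i 10%N; first by constructor 3.
constructor 4; apply/eqP; rewrite eqn_leq -ltnS i12.
by rewrite ltn_neqAle eq_sym i10' i10.
Qed.

Lemma line_point10 : line_point 10 = L.
Proof. by rewrite /line_point /= mul1r. Qed.

Lemma line_point11 : line_point 11 = 2 * L.
Proof. by []. Qed.

(** With [10 <= L], the intervals [[0, 4]] and [[3 L, 3 L + 4]] and the points [L] and [2 L] are
    pairwise disjoint. *)
Lemma line_point_inj i j : 10 <= L -> (i < 12)%N -> (j < 12)%N ->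
  line_point i = line_point j -> i = j.
Proof.
move=> L10; have L2 : L <> 2 * L by move=> ?; lra.
have lr k l : (k < 5)%N -> (5 <= l < 10)%N -> line_point k <> line_point l.
  by move=> /line_point_left ? /line_point_right ? ?; lra.
have ll k l : (k < 5)%N -> (l < 5)%N -> line_point k = line_point l -> k = l.
  by rewrite /line_point => -> -> /eqP; rewrite eqr_nat => /eqP.
have rr k l : (5 <= k < 10)%N -> (5 <= l < 10)%N ->
    line_point k = line_point l -> k = l.
  move=> /andP[k5 k10] /andP[l5 l10].
  rewrite /line_point (ltnNge k) k5 (ltnNge l) l5 /= k10 l10 => /addrI/eqP.
  by rewrite eqr_nat => /eqP kl; rewrite -(subnK k5) kl subnK.
have l10 k : (k < 5)%N -> line_point k <> L by move=> /line_point_left ? ?; lra.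
have l11 k : (k < 5)%N -> line_point k <> 2 * L.
  by move=> /line_point_left ? ?; lra.
have r10 k : (5 <= k < 10)%N -> line_point k <> L.
  by move=> /line_point_right ? ?; lra.
have r11 k : (5 <= k < 10)%N -> line_point k <> 2 * L.
  by move=> /line_point_right ? ?; lra.
move=> /index_cases[i5|i5|->|->] /index_cases[j5|j5|->|->] //;
  rewrite ?line_point10 ?line_point11.
- exact: ll.
- by move=> /lr-/(_ i5 j5).
- by move=> /l10-/(_ i5).
- by move=> /l11-/(_ i5).
- by move=> /esym/lr-/(_ j5 i5).
- exact: rr.
- by move=> /r10-/(_ i5).
- by move=> /r11-/(_ i5).
- by move=> /esym/l10-/(_ j5).
- by move=> /esym/r10-/(_ j5).
- by move=> /L2.
- by move=> /esym/l11-/(_ j5).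
- by move=> /esym/r11-/(_ j5).
- by move=> /esym/L2.
Qed.

(* [K r] has the 1-skeleton of the Rips complex of the points [e i] placed on
   the line at [line_point i]. *)
Definition line_complex (V : choiceType) (n : nat) (e : 'I_n -> V)
    (K : R -> complex V) :=
  [/\ injective e,
      forall r (i j : 'I_n), `|line_point i - line_point j| < 2 * r ->
        [fset e i; e j]%fset \in simplices (K r),
      forall r s x, s \in simplices (K r) -> x \in s -> exists i, x = e i &
      forall r s (i j : 'I_n), s \in simplices (K r) ->
        e i \in s -> e j \in s -> i != j ->
        `|line_point i - line_point j| < 2 * r].

(** The indices [b] to [b + 4] form the block of five neighbours, a whole cluster when [b] is 0 or
    5. The bound 4 holds whether or not [i] belongs to the block. *)
Lemma line_complex_degree (V : choiceType) (n : nat) (e : 'I_n -> V) K r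
    (i : 'I_n) b :
  (10 <= n)%N -> line_complex e K -> (b <= 5)%N ->
  (forall j, (j < 5)%N -> `|line_point i - line_point (b + j)| < 2 * r) ->
  (4 <= degree (K r) (e i))%N.
Proof.
move=> n10 [inj_e edge _ _] b5 near_i.
have lt_n (j : 'I_5) : (b + j < n)%N.
  by rewrite -addnS; exact: leq_trans (leq_add b5 (ltn_ord j)) n10.
rewrite -ltnS.
apply: (@degree_lower_bound _ _ _ 5 (fun j => e (Ordinal (lt_n j)))).
  by move=> j k /inj_e /(congr1 val) /= /addnI /ord_inj.
by move=> j; apply: edge; exact: near_i.
Qed.

Lemma cluster_diameter i : (i < 10)%N -> exists2 b, (b <= 5)%N &
  forall j, (j < 5)%N -> `|line_point i - line_point (b + j)| <= 4.
Proof.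
move=> i10; have [i5|i5] := ltnP i 5.
  exists 0%N => // j /line_point_left; move: (line_point_left i5) => {i5 i10}.
  by rewrite add0n ler_norml; lra.
exists 5%N => // j j5; have := @line_point_right (5 + j).
rewrite leq_addr (ltn_add2l 5 _ 5) j5 => /(_ isT).
have := @line_point_right i; rewrite i5 i10 => /(_ isT) {i5 i10 j5}.
by rewrite ler_norml; lra.
Qed.

(** The point at [L] is served by the left cluster and the point at [2 L] by the right one, so the
    extra points also have large degree once the radius exceeds [(L + 4) / 2]. *)
Lemma cluster_near i : 10 <= L -> (i < 12)%N -> exists2 b, (b <= 5)%N &
  forall j, (j < 5)%N -> `|line_point i - line_point (b + j)| <= L + 4.
Proof.
move=> L10 i12; have [i10|i10] := ltnP i 10.
  have [b b5 near_i] := cluster_diameter i10; exists b => // j /near_i.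
  by move=> {i10 i12} /le_trans; apply; lra.
have [|/andP[_]|->|->] := index_cases i12.
- by move=> i5; have := leq_trans i5 (leq_trans (isT : 5 <= 10)%N i10);
    rewrite ltnn.
- by rewrite ltnNge i10.
- exists 0%N => // j /line_point_left; rewrite line_point10 add0n {i10 i12}.
  by rewrite ler_norml; lra.
- exists 5%N => // j j5; have := @line_point_right (5 + j).
  rewrite leq_addr (ltn_add2l 5 _ 5) j5 line_point11 => /(_ isT) {i10 i12 j5}.
  by rewrite ler_norml; lra.
Qed.

Lemma left_near10 i : 10 <= L -> (i < 5)%N ->
  `|line_point i - line_point 10| <= L.
Proof.
move=> L10 /line_point_left; rewrite line_point10.
by rewrite ler_norml; lra.
Qed.

Lemma right_near11 i : 10 <= L -> (5 <= i < 10)%N ->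
  `|line_point i - line_point 11| <= L + 4.
Proof.
move=> L10 /line_point_right; rewrite line_point11.
by rewrite ler_norml; lra.
Qed.

Lemma clusters_far i j : (i < 5)%N -> (5 <= j < 10)%N ->
  3 * L - 4 <= `|line_point i - line_point j|.
Proof.
move=> /line_point_left ? /line_point_right ?.
by rewrite distrC; apply: le_trans (ler_norm _); lra.
Qed.

End LinePoints.

(** * Failure of interleaving for both kinds of complexes *)

Section LineNotInterleaved.
Variables (R : realType) (c : R).

(* The radii below double to 2 start_radius > 4, which covers a cluster, to
   gap + 5, which joins consecutive points of the chain, and to
   c (gap + 5) + 2/5 < 3 gap - 4, which keeps the two clusters apart. *)
Definition gap : R := 20 / (3 - c).

Lemma gapE : c < 3 -> c * gap = 3 * gap - 20.
Proof. by move=> hc3; rewrite /gap; field; rewrite subr_eq0 gt_eqF. Qed.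

Lemma gap_ge10 : 1 <= c -> c < 3 -> 10 <= gap.
Proof. by move=> hc hc3; rewrite /gap ler_pdivlMr; lra. Qed.

Definition start_radius : R := ((gap + 5) / 2 - 5^-1) / c.

Lemma start_radiusE : 1 <= c -> c * start_radius + 5^-1 = (gap + 5) / 2.
Proof.
move=> hc; rewrite /start_radius; field.
by rewrite gt_eqF// (lt_le_trans ltr01).
Qed.

Lemma start_radius_gt2 : 1 <= c -> c < 3 -> 2 < start_radius.
Proof.
move=> hc hc3; rewrite /start_radius ltr_pdivlMr; last by lra.
by have := gap_ge10 hc hc3; lra.
Qed.

(** Čech and Rips complexes are treated at once through [line_complex]. The numbers 12 and 10 are
    the cardinalities that normalize the degree, and [5^-1] is the value of [delta]. *)
Lemma line_not_interleaved (hc : 1 <= c) (hc3 : c < 3)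
    (V W : choiceType) (e : 'I_12 -> V) (e' : 'I_10 -> W)
    (K : R -> complex V) (K' : R -> complex W) (T : J R -> complex V)
    (S : J R -> complex W) hT hS (hdelta : 0 <= 5^-1) :
  line_complex gap e K -> line_complex gap e' K' ->
  (forall x, T x = degree_complex (K (sval x).2) ((sval x).1 * 12)) ->
  (forall x, S x = degree_complex (K' (sval x).2) ((sval x).1 * 10)) ->
  ~ homotopy_interleaved (linear_shift hdelta hc)
      (@bifiltration R V T hT) (@bifiltration R W S hS).
Proof.
move=> lK lK' TE SE.
have [inj_e edge vert _] := lK; have [inj_e' edge' vert' far'] := lK'.
have L10 := gap_ge10 hc hc3; have cL := gapE hc3.
have r2 := start_radius_gt2 hc hc3.
(* The density [2^-1] gives the threshold [10 / 2 - 1 = 4] at [start], exactly the degree guaranteed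
   inside a cluster of five. At [middle] the threshold is [12 * 3 / 10 - 1], again below 4, and
   after two shifts the density is still [1 / 10 > 0], so [final] lies in [J]. *)
have start_pos : (0 < ((2^-1, start_radius) : R * R).1) &&
    (0 < ((2^-1, start_radius) : R * R).2) by apply/andP; split=> /=; lra.
have middle_pos : (0 < ((2^-1 - 5^-1, (gap + 5) / 2) : R * R).1) &&
    (0 < ((2^-1 - 5^-1, (gap + 5) / 2) : R * R).2).
  by apply/andP; split=> /=; lra.
have final_pos :
    (0 < ((2^-1 - 5^-1 - 5^-1, c * ((gap + 5) / 2) + 5^-1) : R * R).1) &&
    (0 < ((2^-1 - 5^-1 - 5^-1, c * ((gap + 5) / 2) + 5^-1) : R * R).2).
  by apply/andP; split=> /=; lra.
pose start : J R := exist _ (2^-1, start_radius) start_pos.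
pose middle : J R := exist _ (2^-1 - 5^-1, (gap + 5) / 2) middle_pos.
pose final : J R :=
  exist _ (2^-1 - 5^-1 - 5^-1, c * ((gap + 5) / 2) + 5^-1) final_pos.
(* All vertices meet the threshold, so passing to the degree complex removes nothing at [middle]. *)
have inT s : s \in simplices (K ((gap + 5) / 2)) -> s \in simplices (T middle).
  rewrite TE => sK; apply: degree_complex_full sK => v /vert.
  move=> /(_ v (fset11 v))[i ->] /=.
  suff : (4 <= degree (K ((gap + 5) / 2)) (e i))%N.
    by rewrite -(ler_nat R); lra.
  have [b b5 near_i] := cluster_near L10 (ltn_ord i).
  apply: (line_complex_degree (b := b)) lK b5 _ => // j /near_i.
  move=> /le_lt_trans; apply.
  by lra.
have inS i : [fset e' i]%fset \in simplices (S start).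
  have r0 : 0 < start_radius by lra.
  rewrite SE; apply: degree_complex_full => [v /vert'|].
    move=> /(_ v (fset11 v))[j ->] /=.
    suff : (4 <= degree (K' start_radius) (e' j))%N.
      by rewrite -(ler_nat R); lra.
    have [b b5 near_j] := cluster_diameter gap (ltn_ord j).
    apply: (line_complex_degree (b := b)) lK' b5 _ => // k /near_j.
    move=> /le_lt_trans; apply.
    by lra.
  have := edge' start_radius i i; rewrite fsetUid; apply.
  by rewrite subrr normr0; lra.
pose x10 : 'I_12 := Ordinal (isT : 10 < 12)%N.
pose x11 : 'I_12 := Ordinal (isT : 11 < 12)%N.
pose a0 : 'I_10 := Ordinal (isT : 0 < 10)%N.
pose b0 : 'I_10 := Ordinal (isT : 5 < 10)%N.
pose A (w : W) := [exists i : 'I_10, (i < 5)%N && (e' i == w)].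
have AE i : A (e' i) = (i < 5)%N.
  apply/existsP/idP => [[j /andP[j5 /eqP/inj_e' <-//]]|i5].
  by exists i; rewrite i5 eqxx.
apply: (@not_homotopy_interleaved R V W _ T S hT hS middle start final
  (e x10) (e x11) (e' a0) (e' b0) A).
- by rewrite /le2 /= /linear_shift_fun /= start_radiusE// !lexx.
- by rewrite /le2 /= /linear_shift_fun /= !lexx.
- apply: inT; apply: edge; rewrite line_point10 line_point11.
  by rewrite ltr_norml; lra.
- move=> v vT; have [i ->] : exists i, v = e i.
    by move: vT; rewrite TE => /degree_complex_sub/vert; apply; exact: fset11.
  have [i5|i5|i10|i11] := index_cases (ltn_ord i).
  + left; apply: inT; apply: edge; apply: le_lt_trans (left_near10 L10 i5) _.
    by lra.
  + right; apply: inT; apply: edge; apply: le_lt_trans (right_near11 L10 i5) _.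
    by lra.
  + by left; apply: inT; apply: edge; rewrite i10 subrr normr0; lra.
  + by right; apply: inT; apply: edge; rewrite i11 subrr normr0; lra.
- exact: inS.
- exact: inS.
(* A simplex of [S final] is one of [K'] at the same radius; if it met both clusters, it would
   contradict [clusters_far]. *)
- move=> t; rewrite SE => /degree_complex_sub tK.
  have sep (i j : 'I_10) : (i < 5)%N -> (5 <= j)%N -> e' i \in t ->
      e' j \in t -> False.
    move=> i5 j5 it jt; have ij : i != j.
      by apply: contraTneq i5 => ->; rewrite -leqNgt.
    have := @clusters_far R gap i j i5; rewrite j5 ltn_ord => /(_ isT).
    move=> /le_lt_trans/(_ (far' _ _ _ _ tK it jt ij)) /=.
    by lra.
  move=> x y xt yt; have [i Ei] := vert' _ _ _ tK xt.
  have [j Ej] := vert' _ _ _ tK yt; subst x y; rewrite !AE.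
  have [i5|i5] := ltnP i 5; have [j5|j5] := ltnP j 5 => //.
    by case: (sep i j).
  by case: (sep j i).
- by rewrite AE.
- by rewrite AE.
Qed.

End LineNotInterleaved.

HB.instance Definition _ (R : realType) := Pointed.on R^o.

(** * Rips and Čech complexes of points on the line *)

Section LineComplexes.
Variables (R : realType) (L : R).
Local Open Scope fset_scope.
Local Open Scope ring_scope.

Lemma fset2_subset_image (V : choiceType) n (e : 'I_n -> V) i j :
  [fset e i; e j] `<=` [fset e i | i in 'I_n].
Proof.
by apply/fsubsetP => x; rewrite !inE => /orP[]/eqP->; exact: in_imfset.
Qed.

Lemma fset2_neq0 (V : choiceType) (x y : V) : [fset x; y] != fset0.
Proof. by apply/fset0Pn; exists x; exact: fset21. Qed.

Lemma rips_line_complex (M : metricType R) n (e : 'I_n -> M) : injective e ->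
  (forall i j, mdist (e i) (e j) = `|line_point L i - line_point L j|) ->
  line_complex L e (rips [fset e i | i in 'I_n]).
Proof.
move=> inj_e de; split=> //.
- move=> r i j ij; rewrite !inE fpowersetE fset2_subset_image fset2_neq0 /=.
  apply/asboolP => x y; rewrite !inE => /orP[]/eqP-> /orP[]/eqP->;
    rewrite ?eqxx// => _; rewrite de//.
  by rewrite distrC.
- move=> r s x; rewrite !inE fpowersetE => /andP[/fsubsetP sX _] /sX.
  by move=> /imfsetP[i _ ->]; exists i.
- move=> r s i j; rewrite !inE => /and3P[_ _ /asboolP far] si sj ij.
  by rewrite -de; apply: far => //; rewrite (inj_eq inj_e).
Qed.

Lemma cech_line_complex n (e : 'I_n -> R^o) : injective e ->
  (forall i, e i = line_point L i) ->
  line_complex L e (cech [fset e i | i in 'I_n]).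
Proof.
move=> inj_e eE; split=> //.
- move=> r i j; rewrite ltr_norml => ij.
  rewrite !inE fpowersetE fset2_subset_image fset2_neq0 /=.
  (* On the line, two balls of radius [r] whose centers are less than [2 r] apart share the
     midpoint. *)
  apply/asboolP; exists ((e i + e j) / 2) => x.
  rewrite /= !inE !eE => /orP[]/eqP->;
    rewrite /ball /= ?eE ltr_norml; move: ij;
    move: (line_point L i) (line_point L j) => a b; lra.
- move=> r s x; rewrite !inE fpowersetE => /andP[/fsubsetP sX _] /sX.
  by move=> /imfsetP[i _ ->]; exists i.
- move=> r s i j; rewrite !inE => /and3P[_ _ /asboolP[z hz]] si sj _.
  have := hz _ si; have := hz _ sj.
  rewrite /ball /= !eE !ltr_norml.
  move: (line_point L i) (line_point L j) => a b; lra.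
Qed.

End LineComplexes.

(** * The real line is a good metric space *)

Section Convex.
Variable R : realType.

(** The hypothesis is star-shapedness about [a], which is what the straight-line contraction to [a]
    uses. *)
Lemma convex_contractible (A : set R^o) a :
  A a -> (forall x (t : R), A x -> 0 <= t <= 1 -> A (x + t * (a - x))) ->
  contractible R (set_type A).
Proof.
move=> Aa convA; pose a' : set_type A := SigSub (mem_set Aa).
exists a'.
have HA (xt : set_type A * unitI R) :
    A (set_val xt.1 + set_val xt.2 * (a - set_val xt.1)).
  apply: convA; first exact: set_valP.
  by have := set_valP xt.2; rewrite /= in_itv.
exists (fun xt => SigSub (mem_set (HA xt))); split=> //.
- apply: continuous_comp_initial => xt.
  pose v1 (xt : set_type A * unitI R) : R^o := set_val xt.1.
  pose v2 (xt : set_type A * unitI R) : R^o := set_val xt.2.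
  have c1 : {for xt, continuous v1}.
    apply: continuous_comp; first exact: cvg_fst.
    exact: set_val_continuous.
  have c2 : {for xt, continuous v2}.
    apply: continuous_comp; first exact: cvg_snd.
    exact: set_val_continuous.
  apply: (@continuousD R R^o _ v1 (fun xt => v2 xt * (a - v1 xt))) => //.
  apply: (@continuousM R _ v2) => //.
  apply: (@continuousB R R^o _ (cst a)) => //; exact: cst_continuous.
- by move=> s t t0; apply: val_inj; rewrite /= t0 mul0r addr0.
- by move=> s t t1; apply: val_inj; rewrite /= t1 mul1r addrC subrK.
Qed.

Lemma convex_comb_gt0 (t u v : R) : 0 <= t -> t <= 1 -> 0 < u -> 0 < v ->
  0 < (1 - t) * u + t * v.
Proof.
rewrite le_eqVlt => /orP[/eqP<- _ u0 _|t0 t1 u0 v0].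
  by rewrite subr0 mul1r mul0r addr0.
by apply: ltr_wpDl; [rewrite mulr_ge0 ?subr_ge0// ltW|rewrite mulr_gt0].
Qed.

Lemma line_good : good (R^o : pmetricType R).
Proof.
move=> s A; have [A0|/set0P[a Aa]] := eqVneq A set0; [by left|right].
apply: (convex_contractible (a := a)) => // x t Ax /andP[t0 t1] b bs.
have := Ax b bs; have := Aa b bs; rewrite /ball /= !ltr_norml.
move: b.1 b.2 => y r /andP[ya1 ya2] /andP[yx1 yx2].
(* These are the slacks in the inequalities defining the ball, at [x] and at [a]. The slacks at
   [x + t * (a - x)] are their convex combinations, hence still positive. *)
have u1 : 0 < r - (y - x) by rewrite subr_gt0.
have v1 : 0 < r - (y - a) by rewrite subr_gt0.
have u2 : 0 < r + (y - x) by rewrite -ltrBlDl sub0r.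
have v2 : 0 < r + (y - a) by rewrite -ltrBlDl sub0r.
have := convex_comb_gt0 t0 t1 u1 v1; have := convex_comb_gt0 t0 t1 u2 v2.
by move=> {s A Aa Ax bs} ? ?; apply/andP; split; lra.
Qed.

End Convex.

(** * Initial segments of the point set as finite metric spaces *)

Section LineSubspace.
Variables (R : realType) (L : R) (n : nat).
Hypotheses (hL : 10 <= L) (hn : (n.+1 <= 12)%N).

(* The hypotheses are kept as parameters of the type because its metric needs
   [line_point] to be injective. *)
Definition line_subspace : Type := let _ := (hL, hn) in 'I_n.+1.

HB.instance Definition _ := Finite.copy line_subspace 'I_n.+1.
HB.instance Definition _ := isPointed.Build line_subspace (ord0 : 'I_n.+1).

Let dist (i j : 'I_n.+1) : R := `|line_point L j - line_point L i|.

Let distxx i : dist i i = 0.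
Proof. by rewrite /dist subrr normr0. Qed.

Let dist_positivity i j : dist i j = 0 -> i = j.
Proof.
move=> /normr0_eq0/eqP; rewrite subr_eq0 => /eqP/line_point_inj E.
by apply/val_inj; rewrite /= E ?(leq_trans (ltn_ord _)).
Qed.

Let dist_sym i j : dist i j = dist j i.
Proof. exact: distrC. Qed.

Let dist_triangle j i k : dist i k <= dist i j + dist j k.
Proof. by rewrite /dist [leRHS]addrC ler_distD. Qed.

HB.instance Definition _ := isMetric.Build R line_subspace
  distxx dist_positivity dist_sym dist_triangle.

Definition line_inclusion : isometric_embedding line_subspace R^o.
Proof.
by exists (fun i : 'I_n.+1 => line_point L i : R^o).
Defined.

Lemma line_subspace_finite : finite_set [set: line_subspace].
Proof. exact: finite_finset. Qed.

(** Puts the vertex set in the form of an indexed image, on which [nu_image] and [rips_line_complex]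
    operate. *)
Lemma points_line_subspace :
  points line_subspace =
    [fset (id : 'I_n.+1 -> line_subspace) i | i in 'I_n.+1]%fset.
Proof.
apply/fsetP => i; rewrite in_fset_set ?inE; last exact: line_subspace_finite.
by rewrite in_setT.
Qed.

End LineSubspace.

(** * Uniform measures and their Prohorov distance *)

Section UniformMeasureOfImage.
Variables (R : realType) (Z : pmetricType R).

(** Counting indices instead of points lets the families of twelve and of ten points be compared
    term by term. *)
Definition hits n (e : 'I_n -> Z) (A : set Z) : nat :=
  #|[pred i : 'I_n | `[< A (e i) >]]|.

Lemma card_index_image n (e : 'I_n -> Z) : injective e ->
  #|` [fset e i | i in 'I_n]%fset| = n.
Proof. by move=> inj_e; rewrite card_imfset //= -cardE card_ord. Qed.

Lemma nu_image n (e : 'I_n -> Z) (A : set Z) : injective e ->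
  nu [fset e i | i in 'I_n]%fset A = ((hits e A)%:R / n%:R)%:E.
Proof.
move=> inj_e; rewrite /nu card_index_image// /hits.
set X := [fset e i | i in 'I_n]%fset.
have -> : fset_set (A `&` [set` X]) =
    [fset e i | i in [pred i : 'I_n | `[< A (e i) >]]]%fset.
  apply/fsetP => x; rewrite in_fset_set; last exact: finite_setIr.
  apply/idP/imfsetP => [|[i /= /asboolP Ai ->]].
    move=> /set_mem[Ax /imfsetP[i _ xi]]; exists i => //.
    by rewrite inE -xi.
  by apply: mem_set; split=> //; exact: in_imfset.
by rewrite card_imfset //= -cardE.
Qed.

Lemma hits_sub n (e : 'I_n -> Z) (A B : set Z) : A `<=` B ->
  (hits e A <= hits e B)%N.
Proof.
move=> AB; apply/subset_leq_card/fintype.subsetP => i.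
by rewrite !inE; exact: AB.
Qed.

Lemma hits_recr n (e : 'I_n.+1 -> Z) (A : set Z) :
  hits e A =
    (hits (fun i => e (widen_ord (leqnSn n) i)) A + `[< A (e ord_max) >])%N.
Proof.
rewrite /hits -!sum1_card big_mkcond big_ord_recr /=.
by rewrite [in RHS]big_mkcond; congr (_ + _)%N; case: asboolP.
Qed.

(** If [A] contains [h] of the common ten points and [k <= 2] extra ones, then
    [(h + k) / 12 <= h / 10 + 1 / 6] since [k / 12 <= 1 / 6], and [h / 10 <= (h + k) / 12 + 1 / 6]
    since [h / 60 <= 1 / 6]. Thickening can only enlarge the right-hand sides. *)
Lemma prohorov_line_le (m1 m2 : {measure set (borel Z) -> \bar R})
    (e : 'I_12 -> Z) (e' : 'I_10 -> Z) :
  (forall (i : 'I_10) (j : 'I_12), i = j :> nat -> e' i = e j) ->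
  (forall A : set Z, m1 A = ((hits e A)%:R / 12)%:E) ->
  (forall A : set Z, m2 A = ((hits e' A)%:R / 10)%:E) ->
  (prohorov m1 m2 <= 6^-1%:E)%E.
Proof.
move=> ee' m1E m2E; apply: ge_ereal_sup => _ [A cA <-].
apply: ereal_inf_lbound; exists 6^-1 => //=.
have sub : A `<=` thickening A 6^-1.
  by move=> z Az; exists z => //; rewrite mdistxx invr_gt0 ltr0n.
(* The remainder [k] collects the contributions of the indices 10 and 11. *)
have {}hitsE B : exists2 k, (k <= 2)%N & hits e B = (hits e' B + k)%N.
  rewrite 2!hits_recr -addnA; eexists; last first.
    congr (_ + _)%N; rewrite /hits; apply: eq_card => i; rewrite !inE.
    by congr `[< B _ >]; apply/esym/ee'.
  by do 2!case: asboolP.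
have hits10 B : (hits e' B <= 10)%N.
  by rewrite -[leqRHS](card_ord 10) max_card.
split; first by rewrite invr_ge0 ler0n.
- have := hits_sub e' sub; have [k] := hitsE A.
  rewrite m1E m2E -EFinD lee_fin => + ->; rewrite natrD -!(ler_nat R).
  move: (ler0n R (hits e' A)) => {hitsE hits10}.
  by move=> *; lra.
- have := hits_sub e sub; have [k _] := hitsE A; have := hits10 A.
  rewrite m1E m2E -EFinD lee_fin => + ->; rewrite -!(ler_nat R) natrD.
  move: (ler0n R k) => {hitsE hits10}.
  by move=> *; lra.
Qed.

End UniformMeasureOfImage.

(** * The counterexamples for degree-Čech and degree-Rips *)

Theorem proposition3p7 (R : realType) (c : R) (hc : 1 <= c) (hc3 : c < 3) :
  (exists (Z : pmetricType R) (X Y : {fset Z}) (delta : R)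
      (hdelta : 0 <= delta),
    [/\ good Z, X != fset0, Y != fset0,
        (prohorov (nu X) (nu Y) < delta%:E)%E &
        ~ homotopy_interleaved (linear_shift hdelta hc)
            (degree_cech X) (degree_cech Y)])
  /\
  (exists (X Y : pmetricType R) (delta : R) (hdelta : 0 <= delta),
    [/\ finite_set [set: X], finite_set [set: Y],
        (gromov_prohorov (mu X) (mu Y) < delta%:E)%E &
        ~ homotopy_interleaved (linear_shift hdelta hc)
            (degree_rips X) (degree_rips Y)]).
Proof.
have L10 := gap_ge10 hc hc3; set L := gap c in L10.
(* [delta = 1 / 5] is strictly above the Prohorov bound [1 / 6], yet small enough that shifting the
   density [1 / 2] twice keeps it positive. *)
have hdelta : (0 : R) <= 5^-1 by rewrite invr_ge0 ler0n.
have lt65 : (6^-1%:E < (5^-1 : R)%:E)%E.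
  by rewrite lte_fin ltf_pV2 ?posrE ?ltr0n ?ltr_nat.
split.
  pose e n (i : 'I_n) : R^o := line_point L i.
  have inj_e n : (n <= 12)%N -> injective (@e n).
    move=> n12 i j /(line_point_inj L10) ij; apply: ord_inj; apply: ij.
      exact: leq_trans (ltn_ord i) n12.
    exact: leq_trans (ltn_ord j) n12.
  have inj12 := inj_e 12%N isT; have inj10 := inj_e 10%N isT.
  exists R^o, [fset @e 12 i | i in 'I_12]%fset.
  exists [fset @e 10 i | i in 'I_10]%fset, 5^-1, hdelta; split.
  - exact: line_good.
  - by rewrite -cardfs_gt0 card_index_image.
  - by rewrite -cardfs_gt0 card_index_image.
  - apply: le_lt_trans lt65.
    apply: (prohorov_line_le (e := @e 12) (e' := @e 10)).
    + by move=> i j ij; rewrite /e ij.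
    + by move=> A; exact: nu_image.
    + by move=> A; exact: nu_image.
  - apply: (line_not_interleaved hc3 (cech_line_complex inj12 _)
      (cech_line_complex inj10 _)) => // x.
    + by rewrite /degree_cech_complex card_index_image.
    + by rewrite /degree_cech_complex card_index_image.
pose X := line_subspace L10 (isT : 12 <= 12)%N.
pose Y := line_subspace L10 (isT : 10 <= 12)%N.
pose f : isometric_embedding X R^o := line_inclusion L10 (isT : 12 <= 12)%N.
pose g : isometric_embedding Y R^o := line_inclusion L10 (isT : 10 <= 12)%N.
exists X, Y, 5^-1, hdelta; split.
- exact: line_subspace_finite.
- exact: line_subspace_finite.
- apply: le_lt_trans lt65.
  (* The inclusions into the line are one admissible pair of embeddings, so they bound the infimum
     from above. *)
  apply: (@le_trans _ _ (prohorov
    (embedded_measure f (mu X)) (embedded_measure g (mu Y)))).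
    by apply: ereal_inf_lbound; exists R^o, f, g.
  apply: (prohorov_line_le (e := fun i : 'I_12 => line_point L i : R^o)
    (e' := fun i : 'I_10 => line_point L i : R^o)).
  + by move=> i j ->.
  + move=> A; rewrite /= /embedded_measure /pushforward /mu points_line_subspace.
    by rewrite nu_image.
  + move=> A; rewrite /= /embedded_measure /pushforward /mu points_line_subspace.
    by rewrite nu_image.
- rewrite /degree_rips /degree_rips_on.
  apply: (line_not_interleaved hc3
    (rips_line_complex (M := X) (e := id : 'I_12 -> X) _ _)
    (rips_line_complex (M := Y) (e := id : 'I_10 -> Y) _ _)) => //.
  + by move=> i j; rewrite -[RHS]distrC.
  + by move=> i j; rewrite -[RHS]distrC.
  + by move=> x; rewrite /degree_rips_complex points_line_subspace
      card_index_image.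
  + by move=> x; rewrite /degree_rips_complex points_line_subspace
      card_index_image.
Qed.
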